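(* Let $\mu>0$ and $\gamma\in\mathbb{R}$. A number $z\in\mathbb{C}\setminus\Sigma_\mu$ is an eigenvalue of the operator $\mathcal{A}_\mu$ if and only if $\lambda=1$ is an eigenvalue of the integral operator $T_\mu(z)$ acting in $L_2(\mathbb{T}^3)$ by $$(T_\mu(z)g)(p)=\frac{\mu^2}{2\Delta_\mu(p;z)}\int_{\mathbb{T}^3}\frac{g(t)\,dt}{w_2(p,t)-z}.$$ Moreover, the multiplicity of $z$ as an eigenvalue of $\mathcal{A}_\mu$ equals the multiplicity of $1$ as an eigenvalue of $T_\mu(z)$.
   Context: $\mathbb{T}^3=(-\pi,\pi]^3$ is the three-dimensional torus with normalized Haar measure. $\mathcal{H}_1=L_2(\mathbb{T}^3)$, $\mathcal{H}_2=L_2^{\rm s}((\mathbb{T}^3)^2)$ (square-integrable symmetric functions $f(k,p)=f(p,k)$), $\mathcal{H}=\mathcal{H}_1\oplus\mathcal{H}_2$. Let $\varepsilon(k)=\sum_{i=1}^3(1-\cos k_i)$, $w_1(k)=\varepsilon(k)+\gamma$ with $\gamma\in\mathbb{R}$, and $w_2(k,p)=\varepsilon(k)+\varepsilon(\tfrac12(k+p))+\varepsilon(p)$. For $\mu>0$, $\mathcal{A}_\mu$ is the bounded self-adjoint operator on $\mathcal{H}$ given by $\mathcal{A}_\mu=\begin{pmatrix}A_{11}&\mu A_{12}\\ \mu A_{12}^*&A_{22}\end{pmatrix}$, where $(A_{11}f_1)(k)=w_1(k)f_1(k)$, $(A_{12}f_2)(k)=\int_{\mathbb{T}^3}f_2(k,s)\,ds$,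 $(A_{12}^*f_1)(k,p)=\tfrac12(f_1(k)+f_1(p))$, $(A_{22}f_2)(k,p)=w_2(k,p)f_2(k,p)$. For $k\in\mathbb{T}^3$ let $m(k)=\min_p w_2(k,p)$, $M(k)=\max_p w_2(k,p)$, $I(k;z)=\int_{\mathbb{T}^3}\frac{dt}{w_2(k,t)-z}$ and $\Delta_\mu(k;z)=w_1(k)-z-\frac{\mu^2}{2}I(k;z)$ for $z\in\mathbb{C}\setminus[m(k),M(k)]$. Let $\mathcal{A}_\mu(k)$ be the operator on $\mathbb{C}\oplus L_2(\mathbb{T}^3)$ given by $\mathcal{A}_\mu(k)(f_0,f_1)=\big(w_1(k)f_0+\tfrac{\mu}{\sqrt2}\int_{\mathbb{T}^3}f_1(t)dt,\ \tfrac{\mu}{\sqrt2}f_0+w_2(k,\cdot)f_1(\cdot)\big)$; its discrete spectrum is $\{z\in\mathbb{C}\setminus[m(k),M(k)]:\Delta_\mu(k;z)=0\}$. Set $m=\min_{k,p}w_2(k,p)$, $M=\max_{k,p}w_2(k,p)$, $\Lambda_\mu=\bigcup_{k\in\mathbb{T}^3}\sigma_{\rm disc}(\mathcal{A}_\mu(k))$, and $\Sigma_\mu=[m,M]\cup\Lambda_\mu$. *)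

(* Defs.v *)
From HB Require Import structures.
From mathcomp Require Import all_boot all_order all_algebra.
From mathcomp Require Import all_classical all_reals all_analysis.
From mathcomp Require Import complex.

Set Implicit Arguments.
Unset Strict Implicit.
Unset Printing Implicit Defensive.

Import Order.TTheory GRing.Theory Num.Theory.
Local Open Scope ring_scope.
Local Open Scope classical_set_scope.

Section TorusModel.
Variable R : realType.

(* Points of T^3 are represented by triples ((k1,k2),k3) of reals; the torus
   itself is the fundamental box (-pi,pi]^3 (see Tor). *)
Definition P := ((R * R) * R)%type.

Local Notation mu1 := (@lebesgue_measure R).
Local Notation mu3 := ((mu1 \x mu1) \x mu1)%E.
(* The product measure on T^3 x T^3 is realized as the 6-fold product
   ((((((L x L) x L) x L) x L) x L) on P6 = ((P * R) * R) * R, a point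
   (((k, p1), p2), p3) standing for the pair (k, ((p1,p2),p3)). *)
Local Notation mu6 := (((mu3 \x mu1) \x mu1) \x mu1)%E.

Definition Tor : set P := (`](- pi), pi] `*` `](- pi), pi]) `*` `](- pi), pi].
Definition P6 := (((P * R) * R) * R)%type.
Definition kof (q : P6) : P := q.1.1.1.
Definition pof (q : P6) : P := ((q.1.1.2, q.1.2), q.2).

Definition Tor2 : set P6 :=
  ((Tor `*` `](- pi), pi]) `*` `](- pi), pi]) `*` `](- pi), pi].

Definition eps (k : P) : R :=
  (1 - cos k.1.1) + (1 - cos k.1.2) + (1 - cos k.2).

(* (k+p)/2 computed on the representatives in (-pi,pi]^3 *)
Definition halfsum (k p : P) : P :=
  (((k.1.1 + p.1.1) / 2, (k.1.2 + p.1.2) / 2), (k.2 + p.2) / 2).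

Definition w1 (gamma : R) (k : P) : R := eps k + gamma.
Definition w2 (k p : P) : R := eps k + eps (halfsum k p) + eps p.

(* integral over T^3 w.r.t. the normalized Haar measure dt/(2pi)^3,
   for complex valued functions (real and imaginary parts separately) *)
Definition cint (f : P -> R[i]) : R[i] :=
  (((2 * pi) ^- 3 * Rintegral mu3 Tor (fun t => complex.Re (f t)))%:C
   + 'i * ((2 * pi) ^- 3 * Rintegral mu3 Tor (fun t => complex.Im (f t)))%:C)%C.

Definition mk (k : P) : R := inf [set w2 k p | p in Tor].
Definition Mk (k : P) : R := sup [set w2 k p | p in Tor].
Definition mglob : R := inf [set w2 (kof kp) (pof kp) | kp in Tor2].
Definition Mglob : R := sup [set w2 (kof kp) (pof kp) | kp in Tor2].

Definition inSeg (a b : R) (z : R[i]) : Prop := complex.Im z = 0 /\ a <= complex.Re z <= b.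

Definition Ikz (k : P) (z : R[i]) : R[i] := cint (fun t => ((w2 k t)%:C - z)^-1)%C.

Definition Delta (mu gamma : R) (k : P) (z : R[i]) : R[i] :=
  ((w1 gamma k)%:C - z - (mu ^+ 2 / 2)%:C * Ikz k z)%C.

(* Lambda_mu = union over k of sigma_disc(A_mu(k)), where (as stated in the
   context) sigma_disc(A_mu(k)) = {z notin [m(k),M(k)] | Delta_mu(k;z) = 0} *)
Definition Lambda (mu gamma : R) (z : R[i]) : Prop :=
  exists k, Tor k /\ ~ inSeg (mk k) (Mk k) z /\ Delta mu gamma k z = 0.

Definition Sigma (mu gamma : R) (z : R[i]) : Prop :=
  inSeg mglob Mglob z \/ Lambda mu gamma z.

Definition isL2 d (T : measurableType d) (m : {measure set T -> \bar R})
    (A : set T) (f : T -> R[i]) : Prop :=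
  measurable_fun A (fun x => complex.Re (f x)) /\ measurable_fun A (fun x => complex.Im (f x)) /\
  m.-integrable A (fun x => ((complex.Re (f x)) ^+ 2 + (complex.Im (f x)) ^+ 2)%:E).

Definition HA := ((P -> R[i]) * (P -> P -> R[i]))%type.

Definition inH (v : HA) : Prop :=
  isL2 mu3 Tor v.1 /\ isL2 mu6 Tor2 (fun kp => v.2 (kof kp) (pof kp)) /\
  {ae mu6, forall kp, Tor2 kp -> v.2 (kof kp) (pof kp) = v.2 (pof kp) (kof kp)}.

Definition eqH (u v : HA) : Prop :=
  {ae mu3, forall k, Tor k -> u.1 k = v.1 k} /\
  {ae mu6, forall kp, Tor2 kp -> u.2 (kof kp) (pof kp) = v.2 (kof kp) (pof kp)}.

Definition zeroH : HA := (fun _ => 0, fun _ _ => 0).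

Definition scaleH (c : R[i]) (v : HA) : HA :=
  (fun k => c * v.1 k, fun k p => c * v.2 k p).

Definition combH n (c : 'I_n -> R[i]) (v : 'I_n -> HA) : HA :=
  (fun k => \sum_(i < n) c i * (v i).1 k,
   fun k p => \sum_(i < n) c i * (v i).2 k p).

Definition Aop (mu gamma : R) (v : HA) : HA :=
  (fun k => ((w1 gamma k)%:C * v.1 k + mu%:C * cint (v.2 k))%C,
   fun k p => ((mu / 2)%:C * (v.1 k + v.1 p) + (w2 k p)%:C * v.2 k p)%C).

Definition eigvecA (mu gamma : R) (z : R[i]) (v : HA) : Prop :=
  inH v /\ eqH (Aop mu gamma v) (scaleH z v).

Definition is_eigenvalueA (mu gamma : R) (z : R[i]) : Prop :=
  exists v, eigvecA mu gamma z v /\ ~ eqH v zeroH.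

(* multiplicity = dimension of the eigenspace (sup of the sizes of linearly
   independent families of eigenvectors; +oo if unbounded) *)
Definition multA (mu gamma : R) (z : R[i]) : \bar R :=
  ereal_sup [set (n%:R)%:E | n in [set n : nat | exists v : 'I_n -> HA,
     (forall i, eigvecA mu gamma z (v i)) /\
     (forall c : 'I_n -> R[i], eqH (combH c v) zeroH -> forall i, c i = 0)]].

Definition eqL2 (f g : P -> R[i]) : Prop := {ae mu3, forall k, Tor k -> f k = g k}.

Definition Top (mu gamma : R) (z : R[i]) (g : P -> R[i]) : P -> R[i] :=
  fun p => ((mu ^+ 2 / 2)%:C / Delta mu gamma p z *
            cint (fun t => g t / ((w2 p t)%:C - z)))%C.

Definition eigvecT (mu gamma : R) (z lam : R[i]) (g : P -> R[i]) : Prop :=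
  isL2 mu3 Tor g /\ eqL2 (Top mu gamma z g) (fun p => lam * g p).

Definition is_eigenvalueT (mu gamma : R) (z lam : R[i]) : Prop :=
  exists g, eigvecT mu gamma z lam g /\ ~ eqL2 g (fun _ => 0).

Definition multT (mu gamma : R) (z lam : R[i]) : \bar R :=
  ereal_sup [set (n%:R)%:E | n in [set n : nat | exists g : 'I_n -> P -> R[i],
     (forall i, eigvecT mu gamma z lam (g i)) /\
     (forall c : 'I_n -> R[i],
        eqL2 (fun p => \sum_(i < n) c i * g i p) (fun _ => 0) -> forall i, c i = 0)]].

End TorusModel.

(* Main.v *)
(** Since [z] is at positive distance from the range of [w2], the second
    component of the eigenvalue equation [A f = z f] can be solved for [f2]:
    [f2 = - (mu/2) (f1(k) + f1(p)) / (w2 k p - z)].  Substituting this into the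
    first component turns it into
    [Delta(k;z) f1(k) = mu^2/2 * int f1(t) / (w2 k t - z) dt], which is
    [T f1 = f1] because [Delta(.;z)] has no zero.  So [f |-> f1] is a linear
    bijection, modulo null sets, from the eigenspace of [A] for [z] onto that
    of [T] for [1]. *)

Require Import Defs.
From HB Require Import structures.
From mathcomp Require Import all_boot all_order all_algebra.
From mathcomp Require Import all_classical all_reals all_analysis.
From mathcomp Require Import measurable_realfun complex ring lra.

Set Implicit Arguments.
Unset Strict Implicit.
Unset Printing Implicit Defensive.

Import Order.TTheory GRing.Theory Num.Theory.
Local Open Scope ring_scope.
Local Open Scope classical_set_scope.

(** * Tonelli's theorem on the reassociated product *)

Section SigmaFiniteProduct.
Context d1 d2 (T1 : measurableType d1) (T2 : measurableType d2) (R : realType).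
Variables (m1 : {sigma_finite_measure set T1 -> \bar R})
  (m2 : {sigma_finite_measure set T2 -> \bar R}).

(* In MathComp-Analysis the canonical sigma-finite structure on [_ \x _] is
   keyed on subprobabilities, so the one for sigma-finite factors has to be
   rebuilt on an alias before Tonelli's theorem can be iterated. *)
Let prod_measure : set (T1 * T2) -> \bar R := (m1 \x m2)%E.
HB.instance Definition _ := Measure.on prod_measure.
HB.instance Definition _ : isSFinite _ (T1 * T2)%type R prod_measure :=
  lebesgue_integral_fubini.measure_function_Measure_isSigmaFinite__to__measure_function_isSFinite
    m1 m2.
HB.instance Definition _ : isSigmaFinite _ (T1 * T2)%type R prod_measure :=
  lebesgue_integral_fubini.measure_function_Measure_isSigmaFinite__to__measure_function_isSigmaFinite
    m1 m2.
Definition sfprod : {sigma_finite_measure set (T1 * T2)%type -> \bar R} :=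
  prod_measure.
End SigmaFiniteProduct.

Section Tonelli.
Context d d1 d2 d3 (X : measurableType d) (T1 : measurableType d1)
  (T2 : measurableType d2) (T3 : measurableType d3) (R : realType).
Variables (m : {sigma_finite_measure set X -> \bar R})
  (m1 : {sigma_finite_measure set T1 -> \bar R})
  (m2 : {sigma_finite_measure set T2 -> \bar R})
  (m3 : {sigma_finite_measure set T3 -> \bar R}).
Local Open Scope ereal_scope.

Lemma tonelli3 (f : T1 * T2 * T3 -> \bar R) :
  measurable_fun setT f -> (forall q, 0 <= f q) ->
  \int[(m1 \x m2) \x m3]_q f q =
  \int[m1]_x \int[m2]_y \int[m3]_z f (x, y, z).
Proof.
move=> mf f0.
have mF := measurable_fun_fubini_tonelli_F (m2 := m3) f mf f0.
have F0 q : 0 <= fubini_F m3 f q by apply: integral_ge0.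
transitivity (\int[m1 \x m2]_q fubini_F m3 f q).
  exact: (fubini_tonelli1 (m1 := sfprod m1 m2) f mf f0).
exact: (fubini_tonelli1 (fubini_F m3 f) mF F0).
Qed.

(** The nested [fubini_F] on the right are the functions obtained by peeling factors off the
    left-nested fourfold product, and each is measurable as a function of its remaining
    arguments. *)
Lemma tonelli3_section (f : X * T1 * T2 * T3 -> \bar R) (x : X) :
  measurable_fun setT f -> (forall q, 0 <= f q) ->
  \int[(m1 \x m2) \x m3]_y f (x, y.1.1, y.1.2, y.2) =
  fubini_F m1 (fubini_F m2 (fubini_F m3 f)) x.
Proof.
move=> mf f0.
have mg : measurable_fun setT
    (fun y : T1 * T2 * T3 => f (x, y.1.1, y.1.2, y.2)).
  apply: (measurableT_comp mf).
  exact: (measurable_fun_pair (measurable_fun_pair (measurable_fun_pair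
    (measurable_cst x) (measurableT_comp measurable_fst measurable_fst))
    (measurableT_comp measurable_snd measurable_fst)) measurable_snd).
by rewrite (tonelli3 mg).
Qed.

Lemma measurable_tonelli3_section (f : X * T1 * T2 * T3 -> \bar R) :
  measurable_fun setT f -> (forall q, 0 <= f q) ->
  measurable_fun setT
    (fun x => \int[(m1 \x m2) \x m3]_y f (x, y.1.1, y.1.2, y.2)).
Proof.
move=> mf f0; under eq_fun do rewrite tonelli3_section//.
have mF := measurable_fun_fubini_tonelli_F (m2 := m3) f mf f0.
have F0 q : 0 <= fubini_F m3 f q by apply: integral_ge0.
have mG := measurable_fun_fubini_tonelli_F (m2 := m2) _ mF F0.
have G0 q : 0 <= fubini_F m2 (fubini_F m3 f) q by apply: integral_ge0.
exact: measurable_fun_fubini_tonelli_F.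
Qed.

(** Tonelli's theorem removes the last three factors one at a time; [tonelli3_section] then regroups
    the three inner integrals into one over a triple product. *)
Lemma tonelli_assoc (f : X * T1 * T2 * T3 -> \bar R) :
  measurable_fun setT f -> (forall q, 0 <= f q) ->
  \int[((m \x m1) \x m2) \x m3]_q f q =
  \int[m]_x \int[(m1 \x m2) \x m3]_y f (x, y.1.1, y.1.2, y.2).
Proof.
move=> mf f0; under [RHS]eq_integral do rewrite tonelli3_section//.
have mF := measurable_fun_fubini_tonelli_F (m2 := m3) f mf f0.
have F0 q : 0 <= fubini_F m3 f q by apply: integral_ge0.
transitivity (\int[(m \x m1) \x m2]_q fubini_F m3 f q).
  exact: (fubini_tonelli1 (m1 := sfprod (sfprod m m1) m2) f mf f0).
transitivity (\int[m \x m1]_q fubini_F m2 (fubini_F m3 f) q).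
  exact: (fubini_tonelli1 (m1 := sfprod m m1) _ mF F0).
have mG := measurable_fun_fubini_tonelli_F (m2 := m2) _ mF F0.
have G0 q : 0 <= fubini_F m2 (fubini_F m3 f) q by apply: integral_ge0.
by rewrite (fubini_tonelli1 _ mG G0).
Qed.
End Tonelli.

(** * The six-fold product measure as the product of two copies of [mu3], and its null sets *)

Section TorusMeasure.
Variable R : realType.
Local Notation P := (P R).
Local Notation P6 := (P6 R).
Local Notation mu1 := (@lebesgue_measure R).
Local Notation mu3 := ((mu1 \x mu1) \x mu1)%E.
Local Notation mu6 := (((mu3 \x mu1) \x mu1) \x mu1)%E.

(* Inverse of [q |-> (kof q, pof q)]. *)
Definition joinP (k p : P) : P6 := (k, p.1.1, p.1.2, p.2).

Lemma kof_join k p : kof (joinP k p) = k. Proof. by []. Qed.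

Lemma pof_join k p : pof (joinP k p) = p. Proof. by case: p => [[]]. Qed.

Lemma measurable_kof : measurable_fun setT (@kof R).
Proof.
exact: (measurableT_comp (measurableT_comp measurable_fst measurable_fst)
  measurable_fst).
Qed.

Lemma measurable_pof : measurable_fun setT (@pof R).
Proof.
exact: (measurable_fun_pair (measurable_fun_pair
  (measurableT_comp measurable_snd
    (measurableT_comp measurable_fst measurable_fst))
  (measurableT_comp measurable_snd measurable_fst)) measurable_snd).
Qed.

Lemma measurable_joinP k : measurable_fun setT (joinP k).
Proof.
exact: (measurable_fun_pair (measurable_fun_pair (measurable_fun_pair
    (measurable_cst k) (measurableT_comp measurable_fst measurable_fst))
    (measurableT_comp measurable_snd measurable_fst)) measurable_snd).
Qed.

Local Open Scope ereal_scope.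

Lemma torus2_tonelli (f : P6 -> \bar R) :
  measurable_fun setT f -> (forall q, 0 <= f q) ->
  \int[mu6]_q f q = \int[mu3]_k \int[mu3]_p f (joinP k p).
Proof. exact: (tonelli_assoc (sfprod (sfprod mu1 mu1) mu1) mu1 mu1 mu1). Qed.

Lemma integral_kof_pof (u v : P -> \bar R) :
  measurable_fun setT u -> measurable_fun setT v ->
  (forall k, 0 <= u k) -> (forall p, 0 <= v p) ->
  \int[mu6]_q (u (kof q) * v (pof q)) =
  \int[mu3]_k u k * \int[mu3]_p v p.
Proof.
move=> mu' mv u0 v0.
rewrite torus2_tonelli; first last.
- by move=> q; rewrite mule_ge0.
- by apply: emeasurable_funM; apply: measurableT_comp => //;
    [exact: measurable_kof|exact: measurable_pof].
under eq_integral => k _.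
  under eq_integral do rewrite kof_join pof_join.
  rewrite ge0_integralZl//.
over.
by rewrite ge0_integralZr//; exact: integral_ge0.
Qed.

(** The indicator of a rectangle is a product of a function of [kof] and a function of [pof], so its
    integral factors. *)
Lemma measure_kof_pof (A B : set P) : measurable A -> measurable B ->
  mu6 (@kof R @^-1` A `&` @pof R @^-1` B) = mu3 A * mu3 B.
Proof.
move=> mA mB.
have mKA : measurable (@kof R @^-1` A).
  by rewrite -[X in measurable X]setTI; exact: measurable_kof.
have mPB : measurable (@pof R @^-1` B).
  by rewrite -[X in measurable X]setTI; exact: measurable_pof.
rewrite -[LHS](congr1 mu6 (setIT _)) -integral_indic//; last exact: measurableI.
under eq_integral do rewrite indicI EFinM.
rewrite (integral_kof_pof (u := fun k => (\1_A k)%:E)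
  (v := fun k => (\1_B k)%:E)).
- by rewrite !integral_indic ?setIT.
- exact/measurable_EFinP/measurable_indic.
- exact/measurable_EFinP/measurable_indic.
- by move=> k; rewrite lee_fin.
- by move=> k; rewrite lee_fin.
Qed.

Lemma ae_kof (Q : P -> Prop) :
  {ae mu3, forall k, Q k} -> {ae mu6, forall q, Q (kof q)}.
Proof.
move=> [N [mN N0 sub]]; exists (@kof R @^-1` N); split.
- by rewrite -[X in measurable X]setTI; exact: measurable_kof.
(* Here [mu3 setT] is infinite, since [mu3] is Lebesgue measure on the whole space; the convention
   [0 * +oo = 0] makes the cylinder over a null set null. *)
- have := measure_kof_pof mN measurableT.
  by rewrite preimage_setT setIT => ->; rewrite [X in X * _](_ : _ = 0) ?mul0e.
- by move=> q /= /sub.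
Qed.

Lemma ae_pof (Q : P -> Prop) :
  {ae mu3, forall k, Q k} -> {ae mu6, forall q, Q (pof q)}.
Proof.
move=> [N [mN N0 sub]]; exists (@pof R @^-1` N); split.
- by rewrite -[X in measurable X]setTI; exact: measurable_pof.
- have := measure_kof_pof measurableT mN.
  by rewrite preimage_setT setTI => ->; rewrite [X in _ * X](_ : _ = 0) ?mule0.
- by move=> q /= /sub.
Qed.

(** By Tonelli, the measures [F k] of the sections of a null set integrate to 0, so almost every
    section is null. *)
Lemma ae_joinP (Q : P6 -> Prop) :
  {ae mu6, forall q, Q q} ->
  {ae mu3, forall k, {ae mu3, forall p, Q (joinP k p)}}.
Proof.
move=> [N [mN N0 sub]].
pose F k := \int[mu3]_p (\1_N (joinP k p))%:E.
have mf : measurable_fun setT (fun q : P6 => (\1_N q)%:E : \bar R).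
  exact/measurable_EFinP/measurable_indic.
have f0 q : 0 <= (\1_N q)%:E :> \bar R by rewrite lee_fin.
have mF : measurable_fun setT F.
  exact: (measurable_tonelli3_section mu1 mu1 mu1 mf f0).
have F0 k : 0 <= F k by exact: integral_ge0.
have F_ae0 := iffLR (ae_eq_integral_abs mu3 measurableT mF).
apply: filterS (F_ae0 _) => [k /(_ I) Fk|]; last first.
  under eq_integral do rewrite gee0_abs//.
  by rewrite /F -(torus2_tonelli mf f0) integral_indic// setIT.
exists (joinP k @^-1` N).
have mS : measurable (joinP k @^-1` N).
  by rewrite -[X in measurable X]setTI; exact: measurable_joinP.
split => //; last by move=> p /= /sub.
by rewrite -(setIT (_ @^-1` _)) -integral_indic//; exact: Fk.
Qed.
End TorusMeasure.

(** * Complex-valued measurable and square-integrable functions *)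

Section ComplexParts.
Variable R : realType.
Implicit Types x y : R[i].

(** The squared modulus as a real number, convertible to the integrand in [isL2]. *)
Definition normsq x : R := complex.Re x ^+ 2 + complex.Im x ^+ 2.

Lemma complex_ext x y :
  complex.Re x = complex.Re y -> complex.Im x = complex.Im y -> x = y.
Proof. by case: x y => [a b] [c d] /= -> ->. Qed.

Lemma Re_add x y : complex.Re (x + y) = complex.Re x + complex.Re y.
Proof. by case: x y => [a b] [c d]. Qed.

Lemma Im_add x y : complex.Im (x + y) = complex.Im x + complex.Im y.
Proof. by case: x y => [a b] [c d]. Qed.

Lemma Re_mul x y : complex.Re (x * y) =
  complex.Re x * complex.Re y - complex.Im x * complex.Im y.
Proof. by case: x y => [a b] [c d]. Qed.

Lemma Im_mul x y : complex.Im (x * y) =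
  complex.Re x * complex.Im y + complex.Im x * complex.Re y.
Proof. by case: x y => [a b] [c d]. Qed.

Lemma Re_inv x : complex.Re x^-1 = complex.Re x / normsq x.
Proof. by case: x. Qed.

Lemma Im_inv x : complex.Im x^-1 = - (complex.Im x / normsq x).
Proof. by case: x. Qed.

Lemma normsq_ge0 x : 0 <= normsq x.
Proof. by rewrite addr_ge0// sqr_ge0. Qed.

Lemma normsqM x y : normsq (x * y) = normsq x * normsq y.
Proof. by rewrite /normsq Re_mul Im_mul; ring. Qed.

(** By the parallelogram law the two sides differ by the squared modulus of [x - y]. *)
Lemma normsqD x y : normsq (x + y) <= 2 * (normsq x + normsq y).
Proof.
rewrite /normsq Re_add Im_add.
have := sqr_ge0 (complex.Re x - complex.Re y).
have := sqr_ge0 (complex.Im x - complex.Im y).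
nra.
Qed.

Lemma normsq_eq0 x : (normsq x == 0) = (x == 0).
Proof.
rewrite paddr_eq0 ?sqr_ge0// !sqrf_eq0.
by rewrite eq_complex.
Qed.

Lemma normsqV x : normsq x^-1 = (normsq x)^-1.
Proof.
have [->|x0] := eqVneq x 0.
  by rewrite invr0 /normsq /= expr0n/= addr0 invr0.
have n0 : normsq x != 0 by rewrite normsq_eq0.
apply: (mulfI n0).
by rewrite -normsqM !divff// /normsq /= expr1n expr0n/= addr0.
Qed.

End ComplexParts.

Section ComplexMeasurable.
Context d (T : measurableType d) (R : realType).
Implicit Types (A : set T) (f g : T -> R[i]).

Definition cmeasurable_fun A f :=
  measurable_fun A (fun x => complex.Re (f x)) /\
  measurable_fun A (fun x => complex.Im (f x)).

Lemma cmeasurable_cst A (c : R[i]) : cmeasurable_fun A (fun=> c).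
Proof. by split; exact: measurable_cst. Qed.

Lemma cmeasurable_real A (f : T -> R) :
  measurable_fun A f -> cmeasurable_fun A (fun x => (f x)%:C%C).
Proof. by move=> mf; split => //=; exact: measurable_cst. Qed.

Lemma cmeasurable_funD A f g : cmeasurable_fun A f -> cmeasurable_fun A g ->
  cmeasurable_fun A (fun x => f x + g x).
Proof.
move=> [rf jf] [rg jg]; split.
- by under eq_fun do rewrite Re_add; exact: measurable_funD.
- by under eq_fun do rewrite Im_add; exact: measurable_funD.
Qed.

Lemma cmeasurable_funM A f g : cmeasurable_fun A f -> cmeasurable_fun A g ->
  cmeasurable_fun A (fun x => f x * g x).
Proof.
move=> [rf jf] [rg jg]; split.
- under eq_fun do rewrite Re_mul.
  by apply: measurable_funB; exact: measurable_funM.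
- under eq_fun do rewrite Im_mul.
  by apply: measurable_funD; exact: measurable_funM.
Qed.

Lemma measurable_normsq A f :
  cmeasurable_fun A f -> measurable_fun A (fun x => normsq (f x)).
Proof.
by move=> [rf jf]; apply: measurable_funD; exact: measurable_funX.
Qed.

Lemma cmeasurable_funV A f :
  cmeasurable_fun A f -> cmeasurable_fun A (fun x => (f x)^-1).
Proof.
move=> mf; have [rf jf] := mf.
have mV : measurable_fun A (fun x => (normsq (f x))^-1).
  (* On nonnegative reals, 0 included, inversion is the power of exponent -1, and real powers are
     measurable. *)
  under eq_fun do rewrite -powR_inv1 ?normsq_ge0//.
  by have := measurableT_comp (measurable_powR (-1)) (measurable_normsq mf).
split.
- by under eq_fun do rewrite Re_inv; exact: measurable_funM.
- under eq_fun do rewrite Im_inv.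
  by apply: measurable_funN; exact: measurable_funM.
Qed.

End ComplexMeasurable.

Lemma cmeasurable_fun_comp d d' (T : measurableType d) (T' : measurableType d')
    (R : realType) (A : set T) (B : set T') (h : T' -> T) (f : T -> R[i]) :
  measurable A -> measurable B -> h @` B `<=` A ->
  measurable_fun setT h -> cmeasurable_fun A f ->
  cmeasurable_fun B (f \o h).
Proof.
move=> mA mB hBA mh [rf jf].
have mhB : measurable_fun B h by exact: measurable_funTS.
by split; [exact: (measurable_comp mA hBA rf mhB)
          |exact: (measurable_comp mA hBA jf mhB)].
Qed.

Section L2.
Context d (T : measurableType d) (R : realType).
Variables (m : {measure set T -> \bar R}) (A : set T).
Hypothesis mA : measurable A.
Implicit Types f g : T -> R[i].

Lemma isL2_cmeasurable f : isL2 m A f -> cmeasurable_fun A f.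
Proof. by case=> ? []. Qed.

Lemma isL2_le f (b : T -> R) : cmeasurable_fun A f ->
  m.-integrable A (EFin \o b) -> (forall x, A x -> normsq (f x) <= b x) ->
  isL2 m A f.
Proof.
move=> mf ib fb; have [rf jf] := mf; split => //; split => //.
apply: (le_integrable mA _ _ ib).
  exact/measurable_EFinP/measurable_normsq.
move=> x Ax /=; rewrite lee_fin ger0_norm ?normsq_ge0//.
exact: le_trans (fb _ Ax) (ler_norm _).
Qed.

Lemma isL2D f g : isL2 m A f -> isL2 m A g -> isL2 m A (fun x => f x + g x).
Proof.
move=> [rf [jf f2]] [rg [jg g2]].
apply: (isL2_le (b := fun x => 2 * (normsq (f x) + normsq (g x)))).
- exact: cmeasurable_funD.
- exact: (integrableZl mA 2 (integrableD mA f2 g2)).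
- by move=> x _; exact: normsqD.
Qed.

Lemma isL2M f h (c : R) : isL2 m A f -> cmeasurable_fun A h ->
  (forall x, A x -> normsq (h x) <= c) -> isL2 m A (fun x => f x * h x).
Proof.
move=> [rf [jf f2]] mh hc.
apply: (isL2_le (b := fun x => c * normsq (f x))).
- exact: cmeasurable_funM.
- exact: (integrableZl mA c f2).
- by move=> x Ax; rewrite normsqM mulrC ler_wpM2r ?normsq_ge0 ?hc.
Qed.

Definition cintegrable f :=
  m.-integrable A (fun x => (complex.Re (f x))%:E) /\
  m.-integrable A (fun x => (complex.Im (f x))%:E).

Lemma integrable_cst_fin (c : R) :
  (m A < +oo)%E -> m.-integrable A (EFin \o cst c).
Proof.
move=> Afin; apply/integrableP; split.
  exact/measurable_EFinP/measurable_cst.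
rewrite (eq_integral (cst `|c|%:E)) => [|x _]; last by [].
by rewrite integral_cst// lte_mul_pinfty// lee_fin.
Qed.

Lemma isL2_cst (c : R[i]) : (m A < +oo)%E -> isL2 m A (fun=> c).
Proof.
move=> Afin; have mc := @cmeasurable_cst _ T R A c.
by apply: (isL2_le mc (integrable_cst_fin (normsq c) Afin)).
Qed.

(** Both [|Re f|] and [|Im f|] are at most [1 + normsq f], which is integrable on a set of finite
    measure. *)
Lemma isL2_cintegrable f : (m A < +oo)%E -> isL2 m A f -> cintegrable f.
Proof.
move=> Afin [rf [jf f2]].
have i1 := integrable_cst_fin 1 Afin.
have ib := integrableD mA i1 f2.
by split; apply: (le_integrable mA _ _ ib); do ?[exact/measurable_EFinP];
  move=> x Ax /=; rewrite lee_fin;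
  apply: le_trans (ler_norm _); rewrite ler_norml;
  have := sqr_ge0 (complex.Re (f x)); have := sqr_ge0 (complex.Im (f x));
  nra.
Qed.

End L2.

(** * Integration on the torus *)

Section Torus.
Variable R : realType.
Local Notation P := (P R).
Local Notation P6 := (P6 R).
Local Notation Tor := (@Tor R).
Local Notation Tor2 := (@Tor2 R).
Local Notation mu1 := (@lebesgue_measure R).
Local Notation mu3 := ((mu1 \x mu1) \x mu1)%E.
Local Notation mu6 := (((mu3 \x mu1) \x mu1) \x mu1)%E.

Lemma measurable_Tor : measurable Tor.
Proof. by do !apply: measurableX; exact: measurable_itv. Qed.

Lemma Tor2E : Tor2 = @kof R @^-1` Tor `&` @pof R @^-1` Tor.
Proof.
apply/seteqP; split=> -[[[k a] b] c]; rewrite /Defs.Tor2 /Defs.Tor /kof /pof /=;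
  tauto.
Qed.

Lemma Tor2_join k p : Tor k -> Tor p -> Tor2 (joinP k p).
Proof. by move=> Tk Tp; rewrite Tor2E; split => //=; rewrite pof_join. Qed.

Lemma Tor2_kof q : Tor2 q -> Tor (kof q).
Proof. by rewrite Tor2E => -[]. Qed.

Lemma Tor2_pof q : Tor2 q -> Tor (pof q).
Proof. by rewrite Tor2E => -[]. Qed.

Lemma measurable_Tor2 : measurable Tor2.
Proof. by do !apply: measurableX; exact: measurable_itv. Qed.

Lemma mu3_Tor_fin : (mu3 Tor < +oo)%E.
Proof.
pose I : set R := `](- pi), pi].
have mI : measurable I by exact: measurable_itv.
have I_fin : (mu1 I < +oo)%E.
  by rewrite lebesgue_measure_itv/=; case: ifP => // _; rewrite -EFinB ltry.
have I2_fin : ((mu1 \x mu1) (I `*` I) < +oo)%E.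
  rewrite product_measure1E//.
  by rewrite lte_mul_pinfty// ge0_fin_numE.
have -> : mu3 Tor = ((mu1 \x mu1) (I `*` I) * mu1 I)%E.
  exact: (product_measure1E (sfprod mu1 mu1) mu1 (measurableX mI mI) mI).
by rewrite lte_mul_pinfty// ge0_fin_numE.
Qed.

Lemma integral_Tor2 (a b : P -> \bar R) :
  measurable_fun Tor a -> measurable_fun Tor b ->
  (forall k, Tor k -> 0 <= a k)%E -> (forall p, Tor p -> 0 <= b p)%E ->
  (\int[mu6]_(q in Tor2) (a (kof q) * b (pof q)) =
  \int[mu3]_(k in Tor) a k * \int[mu3]_(p in Tor) b p)%E.
Proof.
move=> ma mb a0 b0.
(* Extension by zero reduces the claim to the factorization over the whole space, because [Tor2] is
   the rectangle with both sides [Tor]. *)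
rewrite integral_mkcond [X in _ = (X * _)%E]integral_mkcond.
rewrite [X in _ = (_ * X)%E]integral_mkcond.
rewrite -integral_kof_pof; first last.
- by move=> p; rewrite patchE; case: ifPn => // /set_mem /b0.
- by move=> p; rewrite patchE; case: ifPn => // /set_mem /a0.
- by apply/(measurable_restrictT _ measurable_Tor).
- by apply/(measurable_restrictT _ measurable_Tor).
apply: eq_integral => q _; rewrite !patchE Tor2E in_setI.
rewrite (_ : (q \in @kof R @^-1` Tor) = (kof q \in Tor)) //.
rewrite (_ : (q \in @pof R @^-1` Tor) = (pof q \in Tor)) //.
by case: (kof q \in Tor); case: (pof q \in Tor); rewrite ?mule0 ?mul0e.
Qed.

(** Treats [kof] and [pof] at once: the hypothesis on integrals says that [h] pushes the measure on
    [Tor2] forward to [mu3 Tor] times the measure on [Tor], a finite multiple. *)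
Lemma isL2_proj (h : P6 -> P) (g : P -> R[i]) :
  measurable_fun setT h -> (forall q, Tor2 q -> Tor (h q)) ->
  (forall a : P -> \bar R, measurable_fun Tor a ->
    (forall k, Tor k -> 0 <= a k)%E ->
    (\int[mu6]_(q in Tor2) a (h q) = \int[mu3]_(k in Tor) a k * mu3 Tor)%E) ->
  isL2 mu3 Tor g -> isL2 mu6 Tor2 (g \o h).
Proof.
move=> mh hT hint g2; have gm := isL2_cmeasurable g2; have [_ [_ ig]] := g2.
have mn := measurable_normsq gm.
have mgh : cmeasurable_fun Tor2 (g \o h).
  apply: (cmeasurable_fun_comp measurable_Tor measurable_Tor2 _ mh gm).
  by move=> _ [q Tq <-]; exact: hT.
have n0 k : (0 <= (normsq (g k))%:E)%E by rewrite lee_fin normsq_ge0.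
split; first by case: mgh.
split; first by case: mgh.
apply/integrableP; split; first exact/measurable_EFinP/measurable_normsq.
rewrite [X in (X < _)%E](_ : _ = \int[mu6]_(q in Tor2) (normsq (g (h q)))%:E)%E;
  last by apply: eq_integral => q _; exact: (gee0_abs (n0 (h q))).
rewrite (hint (fun k => (normsq (g k))%:E)) //; last exact/measurable_EFinP.
have [_ ig_fin] := integrableP _ _ _ ig.
apply: lte_mul_pinfty; last exact: mu3_Tor_fin.
  exact: integral_ge0.
rewrite ge0_fin_numE; last exact: integral_ge0.
apply: le_lt_trans ig_fin; apply: ge0_le_integral => //.
- exact: measurable_Tor.
- exact/measurable_EFinP.
- by apply: measurableT_comp => //; exact/measurable_EFinP.
- by move=> k _; rewrite lee_fin ler_norm.
Qed.

Lemma isL2_kof g : isL2 mu3 Tor g -> isL2 mu6 Tor2 (g \o @kof R).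
Proof.
apply: isL2_proj => [||a ma a0]; [exact: measurable_kof|exact: Tor2_kof|].
under eq_integral do rewrite -[a _]mule1.
rewrite (integral_Tor2 (b := cst 1%E))//.
by rewrite integral_cst ?mul1e//; exact: measurable_Tor.
Qed.

Lemma isL2_pof g : isL2 mu3 Tor g -> isL2 mu6 Tor2 (g \o @pof R).
Proof.
apply: isL2_proj => [||a ma a0]; [exact: measurable_pof|exact: Tor2_pof|].
under eq_integral do rewrite -[a _]mul1e.
rewrite (integral_Tor2 (a := cst 1%E))// muleC.
by rewrite integral_cst ?mul1e//; exact: measurable_Tor.
Qed.

Lemma cintE (f : P -> R[i]) : cint f =
  ((2 * pi) ^- 3 * Rintegral mu3 Tor (fun t => complex.Re (f t)) +i*
   ((2 * pi) ^- 3 * Rintegral mu3 Tor (fun t => complex.Im (f t))))%C.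
Proof. by rewrite /cint; apply: complex_ext; rewrite /=; ring. Qed.

Lemma cintD f g : cintegrable mu3 Tor f -> cintegrable mu3 Tor g ->
  cint (fun t => f t + g t) = cint f + cint g.
Proof.
move=> [rf jf] [rg jg]; rewrite !cintE; apply: complex_ext => /=.
- under eq_Rintegral do rewrite Re_add.
  by rewrite RintegralD ?mulrDr//; exact: measurable_Tor.
- under eq_Rintegral do rewrite Im_add.
  by rewrite RintegralD ?mulrDr//; exact: measurable_Tor.
Qed.

Lemma cintZ c f : cintegrable mu3 Tor f ->
  cint (fun t => c * f t) = c * cint f.
Proof.
have mT := measurable_Tor.
move=> [rf jf].
have ra (a : R) : mu3.-integrable Tor (fun t => (a * complex.Re (f t))%:E).
  by apply: (integrableZl _ a rf); exact: measurable_Tor.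
have ja (a : R) : mu3.-integrable Tor (fun t => (a * complex.Im (f t))%:E).
  by apply: (integrableZl _ a jf); exact: measurable_Tor.
rewrite !cintE; apply: complex_ext; rewrite ?Re_mul ?Im_mul /=.
- under eq_Rintegral do rewrite Re_mul.
  rewrite RintegralB//; [|exact: ra|exact: ja].
  by rewrite !RintegralZl//; ring.
- under eq_Rintegral do rewrite Im_mul.
  rewrite RintegralD//; [|exact: ja|exact: ra].
  by rewrite !RintegralZl//; ring.
Qed.

Lemma ae_eq_cint f g : cmeasurable_fun Tor f -> cmeasurable_fun Tor g ->
  eqL2 f g -> cint f = cint g.
Proof.
move=> [rf jf] [rg jg] fg; rewrite !cintE.
by congr (_ * _ +i* (_ * _))%C; rewrite /Rintegral; congr fine;
  apply: ae_eq_integral; do ?[exact: measurable_Tor|exact/measurable_EFinP];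
  apply: (@filterS _ _ (ae_filter_ringOfSetsType mu3) _ _ _ fg);
  move=> t fgt /fgt ->.
Qed.

End Torus.

(** * The dispersion function w2 *)

Section Dispersion.
Variable R : realType.
Local Notation P := (P R).
Local Notation P6 := (P6 R).
Local Notation Tor := (@Tor R).
Local Notation Tor2 := (@Tor2 R).

Lemma w2C (k p : P) : w2 k p = w2 p k.
Proof.
have hC : halfsum k p = halfsum p k.
  by rewrite /halfsum; congr (_ / _, _ / _, _ / _); rewrite addrC.
by rewrite /w2 hC; ring.
Qed.

Lemma eps_ge0 (k : P) : 0 <= eps k.
Proof.
rewrite /eps.
have := cos_le1 k.1.1; have := cos_le1 k.1.2; have := cos_le1 k.2; lra.
Qed.

Lemma eps_le6 (k : P) : eps k <= 6.
Proof.
rewrite /eps.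
have := cos_geN1 k.1.1; have := cos_geN1 k.1.2; have := cos_geN1 k.2; lra.
Qed.

Lemma w2_ge0 (k p : P) : 0 <= w2 k p.
Proof. by rewrite addr_ge0 ?eps_ge0// addr_ge0 ?eps_ge0. Qed.

Lemma w2_le18 (k p : P) : w2 k p <= 18.
Proof.
rewrite /w2; have := eps_le6 k; have := eps_le6 p.
have := eps_le6 (halfsum k p); lra.
Qed.

Lemma w2_mglob k p : Tor k -> Tor p -> mglob R <= w2 k p <= Mglob R.
Proof.
move=> Tk Tp.
have w2_in : [set w2 (kof q) (pof q) | q in Tor2] (w2 k p).
  by exists (joinP k p); [exact: Tor2_join|rewrite pof_join].
apply/andP; split.
(* [inf] and [sup] are genuine bounds only for bounded sets; 0 and 18 bound [w2] because each of its
   three [eps] terms lies between 0 and 6. *)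
- by apply: ge_inf w2_in; exists 0 => _ [q _ <-]; exact: w2_ge0.
- by apply: ub_le_sup w2_in; exists 18 => _ [q _ <-]; exact: w2_le18.
Qed.

Lemma mglob_le_mk k : Tor k -> mglob R <= mk k.
Proof.
move=> Tk; apply: lb_le_inf; first by exists (w2 k k); exists k.
by move=> _ [p Tp <-]; case/andP: (w2_mglob Tk Tp).
Qed.

Lemma Mk_le_Mglob k : Tor k -> Mk k <= Mglob R.
Proof.
move=> Tk; apply: ge_sup; first by exists (w2 k k); exists k.
by move=> _ [p Tp <-]; case/andP: (w2_mglob Tk Tp).
Qed.

(** A zero of [Delta] would put [z] in [Lambda]. Membership there also demands that [z] avoid the
    segment from [mk k] to [Mk k], which holds because that segment lies in the global one. *)
Lemma Delta_neq0 mu gamma z k : ~ Sigma mu gamma z -> Tor k ->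
  Delta mu gamma k z != 0.
Proof.
move=> zS Tk; apply/eqP => D0; apply: (zS); right; exists k; split => //.
split => // -[z0 /andP[mz zM]]; apply: zS; left; split => //.
by rewrite (le_trans (mglob_le_mk Tk) mz) (le_trans zM (Mk_le_Mglob Tk)).
Qed.

(** The constant is the squared distance from [z] to the real axis if [z] is not real, and to the
    nearer end of the global segment otherwise. Being uniform in [k] and [p], it bounds the
    resolvent. *)
Lemma normsq_w2B_gt0 z : ~ inSeg (mglob R) (Mglob R) z ->
  exists2 c, 0 < c &
    forall k p, Tor k -> Tor p -> c <= normsq ((w2 k p)%:C%C - z).
Proof.
have nE k p : normsq ((w2 k p)%:C%C - z) =
    (w2 k p - complex.Re z) ^+ 2 + (complex.Im z) ^+ 2.
  by case: z => a b; rewrite /normsq /= sub0r sqrrN.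
move=> zS; have [z0|z0] := eqVneq (complex.Im z) 0; last first.
  exists (complex.Im z ^+ 2); first by rewrite exprn_even_gt0.
  by move=> k p _ _; rewrite nE lerDr sqr_ge0.
have [zm|mz] := ltP (complex.Re z) (mglob R).
  exists ((mglob R - complex.Re z) ^+ 2); first by rewrite exprn_gt0 ?subr_gt0.
  move=> k p Tk Tp; rewrite nE z0; have /andP[] := w2_mglob Tk Tp; nra.
have [Mz|zM] := ltP (Mglob R) (complex.Re z).
  exists ((complex.Re z - Mglob R) ^+ 2); first by rewrite exprn_gt0 ?subr_gt0.
  move=> k p Tk Tp; rewrite nE z0; have /andP[] := w2_mglob Tk Tp; nra.
by case: zS; split; rewrite ?mz.
Qed.

Lemma measurable_w2 : measurable_fun setT (fun q : P6 => w2 (kof q) (pof q)).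
Proof.
have mcos : measurable_fun setT (@cos R).
  by apply: continuous_measurable_fun; exact: continuous_cos.
have m11 (h : P6 -> P) (mh : measurable_fun setT h) :=
  measurableT_comp measurable_fst (measurableT_comp measurable_fst mh).
have m12 (h : P6 -> P) (mh : measurable_fun setT h) :=
  measurableT_comp measurable_snd (measurableT_comp measurable_fst mh).
have m2 (h : P6 -> P) (mh : measurable_fun setT h) :=
  measurableT_comp measurable_snd mh.
have meps (h : P6 -> P) : measurable_fun setT h ->
    measurable_fun setT (fun x => eps (h x)).
  move=> mh; apply: measurable_funD; [apply: measurable_funD|];
    apply: measurable_funB => //; apply: (measurableT_comp mcos).
  - exact: (m11 _ mh).
  - exact: (m12 _ mh).
  - exact: (m2 _ mh).
have mk := @measurable_kof R; have mp := @measurable_pof R.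
apply: measurable_funD; last exact: meps.
apply: measurable_funD; first exact: meps.
apply: meps.
apply: measurable_fun_pair; [apply: measurable_fun_pair|];
  apply: measurable_funM => //; apply: measurable_funD.
- exact: (m11 _ mk).
- exact: (m11 _ mp).
- exact: (m12 _ mk).
- exact: (m12 _ mp).
- exact: (m2 _ mk).
- exact: (m2 _ mp).
Qed.
End Dispersion.

(** * Eigenvectors *)

Section Eigenvectors.
Variables (R : realType) (mu gamma : R) (z : R[i]).
Hypothesis zS : ~ Sigma mu gamma z.
Local Notation P := (P R).
Local Notation P6 := (P6 R).
Local Notation Tor := (@Tor R).
Local Notation Tor2 := (@Tor2 R).
Local Notation mu1 := (@lebesgue_measure R).
Local Notation mu3 := ((mu1 \x mu1) \x mu1)%E.
Local Notation mu6 := (((mu3 \x mu1) \x mu1) \x mu1)%E.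
Implicit Types (g : P -> R[i]) (v : HA R).

(** The multiplier of the resolvent of the multiplication operator [A22] at [z]. *)
Definition resolv (k p : P) : R[i] := ((w2 k p)%:C%C - z)^-1.

(* The second component of an eigenvector, as determined by the first one. *)
Definition snd_comp g (k p : P) : R[i] :=
  - (mu%:C%C / 2) * (g k + g p) * resolv k p.

(* Type-class resolution does not find these two instances by itself. *)
Let ae3_filter : Filter (almost_everywhere mu3).
Proof. exact: ae_filter_ringOfSetsType. Qed.

Let ae6_filter : Filter (almost_everywhere mu6).
Proof. exact: ae_filter_ringOfSetsType. Qed.

Let zseg : ~ inSeg (mglob R) (Mglob R) z.
Proof. by move=> h; apply: zS; left. Qed.

Lemma resolv_bounded :
  exists c : R, forall k p, Tor k -> Tor p -> normsq (resolv k p) <= c.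
Proof.
have [c c0 cle] := normsq_w2B_gt0 zseg; exists c^-1 => k p Tk Tp.
by rewrite /resolv normsqV lef_pV2 ?posrE ?cle// (lt_le_trans c0)// cle.
Qed.

Lemma w2B_neq0 k p : Tor k -> Tor p -> (w2 k p)%:C%C - z != 0.
Proof.
move=> Tk Tp; rewrite -normsq_eq0 gt_eqF//.
have [c c0 cle] := normsq_w2B_gt0 zseg.
exact: lt_le_trans c0 (cle _ _ Tk Tp).
Qed.

Lemma cmeasurable_resolv :
  cmeasurable_fun setT (fun q : P6 => resolv (kof q) (pof q)).
Proof.
apply: cmeasurable_funV; apply: cmeasurable_funD; last exact: cmeasurable_cst.
by apply: cmeasurable_real; exact: measurable_w2.
Qed.

Lemma cmeasurable_section (f : P -> P -> R[i]) (k : P) : Tor k ->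
  cmeasurable_fun Tor2 (fun q => f (kof q) (pof q)) ->
  cmeasurable_fun Tor (f k).
Proof.
move=> Tk mf.
have -> : f k = (fun q => f (kof q) (pof q)) \o joinP k.
  by apply/funext => p; rewrite /= pof_join.
have := cmeasurable_fun_comp (@measurable_Tor2 R) (@measurable_Tor R) _ _ mf.
apply; last exact: measurable_joinP.
by move=> _ [p Tp <-]; exact: Tor2_join.
Qed.

Lemma isL2_resolv k g : Tor k -> isL2 mu3 Tor g ->
  isL2 mu3 Tor (fun p => g p * resolv k p).
Proof.
move=> Tk g2; have [c cle] := resolv_bounded.
apply: (isL2M _ g2 (c := c)).
- exact: measurable_Tor.
- apply: (cmeasurable_section Tk); have [rm im] := cmeasurable_resolv.
  by split; [exact: measurable_funTS rm|exact: measurable_funTS im].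
- by move=> p Tp; exact: cle.
Qed.

Lemma cintegrable_resolv k g : Tor k -> isL2 mu3 Tor g ->
  cintegrable mu3 Tor (fun p => g p * resolv k p).
Proof.
move=> Tk g2; apply: isL2_cintegrable.
- exact: measurable_Tor.
- exact: mu3_Tor_fin.
- exact: isL2_resolv.
Qed.

(** The sum [g k + g p] is square-integrable over the pairs, and [snd_comp] multiplies it by a
    bounded function. *)
Lemma isL2_snd_comp g : isL2 mu3 Tor g ->
  isL2 mu6 Tor2 (fun q => snd_comp g (kof q) (pof q)).
Proof.
move=> g2; have [c cle] := resolv_bounded.
pose h q := - (mu%:C%C / 2) * resolv (kof q) (pof q) : R[i].
have -> : (fun q => snd_comp g (kof q) (pof q)) =
    (fun q => (g (kof q) + g (pof q)) * h q).
  by apply/funext => q; rewrite /snd_comp /h; ring.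
apply: (isL2M _ (c := normsq (- (mu%:C%C / 2)) * c)).
- exact: measurable_Tor2.
- by apply: isL2D; [exact: measurable_Tor2|exact: isL2_kof|exact: isL2_pof].
- apply: cmeasurable_funM; first exact: cmeasurable_cst.
  have [rm im] := cmeasurable_resolv.
  by split; [exact: measurable_funTS rm|exact: measurable_funTS im].
- move=> q Tq; rewrite /h normsqM ler_wpM2l ?normsq_ge0// cle//.
    exact: Tor2_kof.
  exact: Tor2_pof.
Qed.

(** The term [g k] is constant in the integration variable and comes out as the factor of [Ikz]; the
    other term gives the integral occurring in [Top]. *)
Lemma cint_snd_comp g k : Tor k -> isL2 mu3 Tor g ->
  cint (snd_comp g k) = - (mu%:C%C / 2) *
    (g k * Ikz k z + cint (fun t => g t / ((w2 k t)%:C%C - z))).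
Proof.
move=> Tk g2.
(* The integrand [resolv k] of [Ikz] is treated as the constant 1 times [resolv k]. *)
have one2 : isL2 mu3 Tor (fun=> 1 : R[i]).
  by apply: isL2_cst; [exact: measurable_Tor|exact: mu3_Tor_fin].
have gk2 : isL2 mu3 Tor (fun=> g k).
  by apply: isL2_cst; [exact: measurable_Tor|exact: mu3_Tor_fin].
have i1 := cintegrable_resolv Tk one2.
have i2 := cintegrable_resolv Tk g2.
have i3 := cintegrable_resolv Tk gk2.
have i4 : cintegrable mu3 Tor (fun t => g k * resolv k t + g t * resolv k t).
  apply: isL2_cintegrable; [exact: measurable_Tor|exact: mu3_Tor_fin|].
  apply: isL2D; first exact: measurable_Tor.
    exact: isL2_resolv.
  exact: isL2_resolv.
transitivity (cint (fun t => - (mu%:C%C / 2) *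
    (g k * resolv k t + g t * resolv k t))).
  by congr cint; apply/funext => t; rewrite /snd_comp; ring.
rewrite cintZ// cintD//; congr (_ * (_ + _)).
rewrite -cintZ; last by move: i1; under eq_fun do rewrite mul1r.
by [].
Qed.

(** The [Ikz] term of the integrated second component combines with [w1 - z] into [Delta], leaving
    the equation of [Top] multiplied by [Delta]. *)
Lemma fst_equation g k : Tor k -> isL2 mu3 Tor g ->
  (w1 gamma k)%:C%C * g k + mu%:C%C * cint (snd_comp g k) = z * g k <->
  Top mu gamma z g k = 1 * g k.
Proof.
move=> Tk g2; rewrite cint_snd_comp// /Top mul1r.
have D0 := Delta_neq0 zS Tk; set D := Delta mu gamma k z in D0 *.
set S := cint _; set I := Ikz k z; set W := (w1 gamma k)%:C%C.
set K := (mu ^+ 2 / 2)%:C%C; set M := mu%:C%C.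
have KE : K = M ^+ 2 / 2.
  by rewrite /K rmorphM /= fmorphV /= rmorphXn /= rmorph_nat.
have DE : D = W - z - K * I by [].
have -> : K / D * S = g k <-> D * g k = K * S.
  split=> [<-|e]; last by rewrite mulrAC -e mulrAC mulfV// mul1r.
  by field.
(* With [D] and [K] expanded, the two equations have the same difference of sides. Substituting the
   hypothesis into one of two cancelling terms exhibits this difference as 0. *)
rewrite DE KE; split=> e.
- apply/eqP; rewrite -subr_eq0; apply/eqP.
  by transitivity (z * g k - z * g k); [rewrite -{1}e; field|rewrite subrr].
- apply/eqP; rewrite -subr_eq0; apply/eqP.
  transitivity (M ^+ 2 / 2 * S - M ^+ 2 / 2 * S); last by rewrite subrr.
  by rewrite -{1}e; field.
Qed.

Lemma snd_equation v k p : Tor k -> Tor p ->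
  (mu / 2)%:C%C * (v.1 k + v.1 p) + (w2 k p)%:C%C * v.2 k p = z * v.2 k p <->
  v.2 k p = snd_comp v.1 k p.
Proof.
move=> Tk Tp; have D0 := w2B_neq0 Tk Tp.
rewrite rmorphM /= fmorphV /= rmorph_nat /snd_comp /resolv.
split=> [e|->].
  apply: (mulIf D0); rewrite mulfVK// mulrBr.
  by apply/eqP; rewrite subr_eq; apply/eqP; rewrite [_ * z]mulrC -e; ring.
apply/eqP; rewrite -subr_eq0; apply/eqP; field.
exact: D0.
Qed.

(** On eigenvectors, the inverse of [v |-> v.1] modulo null sets. *)
Definition lift_eigvec g : HA R := (g, snd_comp g).

Lemma eigvecA_snd v : eigvecA mu gamma z v ->
  {ae mu6, forall q, Tor2 q ->
    v.2 (kof q) (pof q) = snd_comp v.1 (kof q) (pof q)}.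
Proof.
case=> _ [_]; apply: (@filterS _ _ ae6_filter) => q eq_q Tq.
apply/(snd_equation v (Tor2_kof Tq) (Tor2_pof Tq)).
exact: eq_q.
Qed.

Lemma eigvecA_eigvecT v : eigvecA mu gamma z v -> eigvecT mu gamma z 1 v.1.
Proof.
move=> vA; have [[v1 [v2 _]] [eq1 _]] := vA; split => //.
(* The formula for [v.2] holds almost everywhere on pairs, whereas [cint (v.2 k)] sees only the
   slice at [k]; on almost every slice the formula holds almost everywhere. *)
have aesnd := ae_joinP (eigvecA_snd vA).
apply: (@filterS2 _ _ ae3_filter _ _ _ _ aesnd eq1) => k snd_k eq_k Tk.
apply/(fst_equation Tk v1); rewrite -[RHS](eq_k Tk) /=; congr (_ + _ * _).
apply/esym/ae_eq_cint.
- exact: (cmeasurable_section Tk (isL2_cmeasurable v2)).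
- exact: (cmeasurable_section Tk (isL2_cmeasurable (isL2_snd_comp v1))).
- apply: (@filterS _ _ ae3_filter _ _ _ snd_k) => p.
  by rewrite pof_join => snd_kp Tp; apply: snd_kp; exact: Tor2_join.
Qed.

Lemma eigvecT_eigvecA g :
  eigvecT mu gamma z 1 g -> eigvecA mu gamma z (lift_eigvec g).
Proof.
move=> [g2 eq1]; split; [split => //; split|split].
- exact: isL2_snd_comp.
(* The lifted second component is symmetric at every point, since [w2] is. *)
- apply: aeW => q _; by rewrite /= /snd_comp /resolv w2C [g (kof q) + _]addrC.
- apply: (@filterS _ _ ae3_filter _ _ _ eq1) => k eq_k Tk.
  by apply/(fst_equation Tk g2); exact: eq_k.
- apply: aeW => q Tq.
  by apply/(snd_equation (lift_eigvec g) (Tor2_kof Tq) (Tor2_pof Tq)).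
Qed.

(** Injectivity of [v |-> v.1]: a null set of the torus pulls back to null sets under both [kof] and
    [pof], off which [snd_comp] vanishes. *)
Lemma eqH_zero v : eqL2 v.1 (fun=> 0) ->
  {ae mu6, forall q, Tor2 q ->
    v.2 (kof q) (pof q) = snd_comp v.1 (kof q) (pof q)} ->
  eqH v (zeroH R).
Proof.
move=> v0 v2; split => //.
apply: (@filterS3 _ _ ae6_filter _ _ _ _ _ v2 (ae_kof v0) (ae_pof v0)).
move=> q e2 ek ep Tq.
rewrite e2// /snd_comp ek ?ep ?addr0 ?mulr0 ?mul0r//.
  exact: Tor2_pof.
exact: Tor2_kof.
Qed.

(** [snd_comp] is linear in its function argument, and the exceptional null sets of finitely many
    eigenvectors have a null union; so the combination is again determined by its first
    component. *)
Lemma eqH_comb_zero n (c : 'I_n -> R[i]) (v : 'I_n -> HA R) :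
  (forall i, eigvecA mu gamma z (v i)) ->
  eqL2 (fun p => \sum_(i < n) c i * (v i).1 p) (fun=> 0) ->
  eqH (combH c v) (zeroH R).
Proof.
move=> vA c0; apply: eqH_zero => //.
have := @filter_forall _ _ _ _ ae6_filter (fun i => eigvecA_snd (vA i)).
apply: (@filterS _ _ ae6_filter) => q snd_q Tq /=.
rewrite /snd_comp -big_split/= mulr_sumr mulr_suml; apply: eq_bigr => i _.
by rewrite snd_q// /snd_comp; ring.
Qed.

End Eigenvectors.

Theorem theorem1 (R : realType) (mu gamma : R) (z : R[i]) :
  0 < mu -> ~ Sigma mu gamma z ->
  (is_eigenvalueA mu gamma z <-> is_eigenvalueT mu gamma z 1) /\
  multA mu gamma z = multT mu gamma z 1.
Proof.
move=> _ zS; split; first split.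
- move=> [v [vA vN0]]; exists v.1; split; first exact: eigvecA_eigvecT.
  by apply: contra_not vN0 => v0; exact: eqH_zero v0 (eigvecA_snd zS vA).
- move=> [g [gT gN0]]; exists (lift_eigvec mu z g).
  by split; [exact: eigvecT_eigvecA|apply: contra_not gN0 => -[]].
(* Both multiplicities are suprema over the sizes of free families of eigenvectors, and the two sets
   of sizes coincide. *)
- congr (ereal_sup (image _ _)); apply/seteqP; split => n.
  + move=> [v [vA vfree]]; exists (fun i => (v i).1); split.
      by move=> i; exact: eigvecA_eigvecT.
    (* A linear relation between the first components is already one between the full
       eigenvectors. *)
    by move=> c c0; apply: vfree; exact: (eqH_comb_zero zS vA c0).
  + move=> [g [gT gfree]]; exists (fun i => lift_eigvec mu z (g i)); split.
      by move=> i; exact: eigvecT_eigvecA.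
    by move=> c [c0 _]; exact: gfree.
Qed.
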